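(* Let $A,B$ be normal $n\times n$ complex matrices and let $f:[0,\infty)\to[0,\infty)$ be concave and e-convex. Then, for every symmetric norm $\|\cdot\|$ on the $n\times n$ complex matrices, $$ \| f(|A+B|)\|\le\|\,f(|A|)+f(|B|)\,\|. $$
   Context: For a complex matrix $X$, $|X|=(X^*X)^{1/2}$. For a positive semi-definite $P$, $f(P)$ is defined by the functional calculus. A function $f$ on $[0,\infty)$ is called e-convex if $t\mapsto f(e^t)$ is convex on $(-\infty,\infty)$. A symmetric (or unitarily invariant) norm is a norm on complex matrices satisfying $\|X\|=\|UXV\|$ for all $X$ and all unitaries $U,V$. *)

(* Defs.v *)
From mathcomp Require Import all_boot all_order all_algebra.
From mathcomp Require Import interval_inference mathcomp_extra boolp.
From mathcomp Require Import classical_sets set_interval reals convex sequences exp.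
From mathcomp Require Import complex.

Set Implicit Arguments.
Unset Strict Implicit.
Unset Printing Implicit Defensive.

Import Order.TTheory GRing.Theory Num.Theory.

Local Open Scope classical_set_scope.
Local Open Scope convex_scope.
Local Open Scope sesquilinear_scope.
Local Open Scope complex_scope.
Local Open Scope ring_scope.

Definition concave_function (R : realType) (D : set R) (f : R -> R) : Prop :=
  forall t : {i01 R},
    {in D &, forall x y : R^o, (f x : R^o) <| t |> (f y : R^o) <= f (x <| t |> y)}.

Definition e_convex (R : realType) (f : R -> R) : Prop :=
  convex_function (E := R^o) setT (fun t => f (expR t)).

(* Meaningful for Hermitian P only: orthomx_spectralP then gives
   P = invmx U *m diag_mx d *m U with U := spectralmx P unitary, and the entries
   of d := spectral_diag P are real by hermitian_spectral_diag_real. For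
   positive semi-definite P they are nonnegative, so only the values of f on
   [0, +oo[ matter. *)
Definition mxfun (R : realType) (n : nat) (f : R -> R) (P : 'M[R[i]]_n) :
    'M[R[i]]_n :=
  invmx (spectralmx P)
    *m diag_mx (map_mx (fun z : R[i] => (f (complex.Re z))%:C) (spectral_diag P))
    *m spectralmx P.

Definition mxabs (R : realType) (n : nat) (X : 'M[R[i]]_n) : 'M[R[i]]_n :=
  mxfun Num.sqrt (X^t* *m X).

Record symmetric_norm (R : realType) (n : nat) (N : 'M[R[i]]_n -> R) : Prop :=
  SymmetricNorm {
    symmetric_norm_ge0 : forall X, 0 <= N X;
    symmetric_norm_eq0 : forall X, N X = 0 -> X = 0;
    symmetric_normD : forall X Y, N (X + Y) <= N X + N Y;
    symmetric_normZ : forall (a : R[i]) X, N (a *: X) = Normc.normc a * N X;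
    symmetric_normU : forall U X V,
      U \is unitarymx -> V \is unitarymx -> N (U *m X *m V) = N X
  }.

(* Main.v *)
(* Every normal X satisfies 2 Re <X x, y> <= <|X| x, x> + <|X| y, y>; adding
   up, Z = A + B is dominated in the same sense by H = |A| + |B|. Testing on
   singular vectors of Z and comparing determinants gives the weak
   log-majorization of the singular values of Z by the eigenvalues of H, so that
   ||f(|Z|)|| <= ||f(H)|| by e-convexity and monotonicity of f.

   For the subadditivity ||f(P + Q)|| <= ||f(P) + f(Q)||, write
   P = sum_k p_k u_k u_k^*, and likewise Q, and let e_l be the eigenvectors of
   P + Q, with eigenvalues m_l. If p_k > 0, then p_k is the combination of the
   m_l with coefficients p_k |<u_k, e_l>|^2 / m_l, of total mass at most 1.
   Concavity of f and Chebyshev's sum inequality (f(t)/t is nonincreasing) bound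
   the sum of f(m_l) over any up-set of the spectrum by the sum of the
   corresponding diagonal entries of f(P) + f(Q) in the basis e_l, and the
   diagonal part of a matrix is an average of its unitary conjugates. *)
Require Import Defs.
From mathcomp Require Import all_boot all_order all_algebra.
From mathcomp Require Import perm.
From mathcomp Require Import classical_sets set_interval reals complex.
From mathcomp Require Import mathcomp_extra boolp interval_inference convex
  sequences exp.
From mathcomp Require Import ring lra.

Set Implicit Arguments.
Unset Strict Implicit.
Unset Printing Implicit Defensive.

Import Order.TTheory GRing.Theory Num.Theory.

Local Open Scope classical_set_scope.
Local Open Scope ring_scope.

(** * Sesquilinear forms, positive semi-definite matrices and domination *)

Section Forms.
Local Open Scope sesquilinear_scope.
Local Open Scope ring_scope.
Variable C : numClosedFieldType.

Lemma adjM m n p (A : 'M[C]_(m, n)) (B : 'M[C]_(n, p)) :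
  (A *m B)^t* = B^t* *m A^t*.
Proof. by rewrite trmx_mul map_mxM. Qed.

Lemma adjD m n (A B : 'M[C]_(m, n)) : (A + B)^t* = A^t* + B^t*.
Proof. by rewrite linearD /= map_mxD. Qed.

Lemma adjB m n (A B : 'M[C]_(m, n)) : (A - B)^t* = A^t* - B^t*.
Proof. by rewrite linearB /= map_mxB. Qed.

Lemma adj1 n : (1%:M : 'M[C]_n)^t* = 1%:M.
Proof. by rewrite trmx1 map_mx1. Qed.

Lemma adj_diag n (d : 'rV[C]_n) : (forall i, 0 <= d 0 i) ->
  (diag_mx d)^t* = diag_mx d.
Proof.
move=> d0; rewrite tr_diag_mx map_diag_mx; congr diag_mx.
by apply/rowP => i; rewrite mxE; apply: geC0_conj.
Qed.

Lemma det_adj n (A : 'M[C]_n) : \det (A^t*) = (\det A)^*.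
Proof. by rewrite det_map_mx det_tr. Qed.

Lemma unitarymxPr n (U : 'M[C]_n) : U \is unitarymx -> U^t* *m U = 1%:M.
Proof. by rewrite -trmxC_unitary => /unitarymxP; rewrite trmxCK. Qed.

(* Vectors are rows, as in the diagonalisation [U^t* *m diag_mx d *m U]. *)
Definition bil m n (P : 'M[C]_(m, n)) (x : 'rV[C]_m) (y : 'rV[C]_n) : C :=
  (x *m P *m y^t*) 0 0.

Definition qf n (P : 'M[C]_n) (x : 'rV[C]_n) : C := bil P x x.

Lemma bilDm m n (P Q : 'M[C]_(m, n)) x y :
  bil (P + Q) x y = bil P x y + bil Q x y.
Proof. by rewrite /bil mulmxDr mulmxDl mxE. Qed.

Lemma bilBm m n (P Q : 'M[C]_(m, n)) x y :
  bil (P - Q) x y = bil P x y - bil Q x y.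
Proof. by rewrite /bil mulmxBr mulmxBl mxE [X in _ + X]mxE. Qed.

Lemma bilM m n p q (P : 'M[C]_(m, n)) (X : 'M[C]_(p, m)) (Y :
  'M[C]_(q, n)) x y :
  bil (X *m P *m Y^t*) x y = bil P (x *m X) (y *m Y).
Proof. by rewrite /bil adjM !mulmxA. Qed.

Lemma bilBl m n (P : 'M[C]_(m, n)) x y z :
  bil P (x - y) z = bil P x z - bil P y z.
Proof. by rewrite /bil !mulmxBl mxE [X in _ + X]mxE. Qed.

Lemma bilBr m n (P : 'M[C]_(m, n)) x y z :
  bil P x (y - z) = bil P x y - bil P x z.
Proof. by rewrite /bil adjB mulmxBr mxE [X in _ + X]mxE. Qed.

Lemma qfDm n (P Q : 'M[C]_n) x : qf (P + Q) x = qf P x + qf Q x.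
Proof. exact: bilDm. Qed.

Lemma qfM m n (P : 'M[C]_n) (X : 'M[C]_(m, n)) x :
  qf (X *m P *m X^t*) x = qf P (x *m X).
Proof. exact: bilM. Qed.

Lemma qf1E n (x : 'rV[C]_n) : qf 1%:M x = \sum_i `|x 0 i| ^+ 2.
Proof.
rewrite /qf /bil mulmx1 mxE; apply: eq_bigr => i _.
by rewrite !mxE normCK.
Qed.

Lemma qf1_ge0 n (x : 'rV[C]_n) : 0 <= qf 1%:M x.
Proof. by rewrite qf1E sumr_ge0 // => i _; rewrite exprn_ge0. Qed.

Lemma qf_gram m n (X : 'M[C]_(m, n)) x : qf (X *m X^t*) x = qf 1%:M (x *m X).
Proof. by rewrite -qfM mulmx1. Qed.

Lemma qf_gram_ge0 m n (X : 'M[C]_(m, n)) x : 0 <= qf (X *m X^t*) x.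
Proof. by rewrite qf_gram qf1_ge0. Qed.

Definition psd n (P : 'M[C]_n) := P^t* = P /\ forall x, 0 <= qf P x.

Lemma psd_gram m n (X : 'M[C]_(m, n)) : psd (X *m X^t*).
Proof. by split; [rewrite adjM trmxCK | exact: qf_gram_ge0]. Qed.

Lemma psd_conj m n (X : 'M[C]_(m, n)) P : psd P -> psd (X *m P *m X^t*).
Proof.
by case=> hP P0; split=> [|x]; [rewrite !adjM trmxCK hP mulmxA|rewrite qfM].
Qed.

Lemma psdD n (P Q : 'M[C]_n) : psd P -> psd Q -> psd (P + Q).
Proof.
move=> [hP P0] [hQ Q0]; split=> [|x]; first by rewrite adjD hP hQ.
by rewrite qfDm addr_ge0.
Qed.

(** Since vectors are rows, the eigenvectors are the rows of [U] when [U] is unitary. *)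
Definition udiag n (U : 'M[C]_n) (d : 'rV[C]_n) := U^t* *m diag_mx d *m U.

Lemma udiagE n (U : 'M[C]_n) d : udiag U d = U^t* *m diag_mx d *m (U^t*)^t*.
Proof. by rewrite trmxCK. Qed.

Lemma qf_diag n (d : 'rV[C]_n) x :
  qf (diag_mx d) x = \sum_i d 0 i * `|x 0 i| ^+ 2.
Proof.
rewrite /qf /bil mxE; apply: eq_bigr => i _.
by rewrite mul_mx_diag !mxE normCK mulrAC mulrC.
Qed.

Lemma psd_diag n (d : 'rV[C]_n) : (forall i, 0 <= d 0 i) -> psd (diag_mx d).
Proof.
move=> d0; split; first exact: adj_diag.
by move=> x; rewrite qf_diag sumr_ge0 // => i _; rewrite mulr_ge0 // exprn_ge0.
Qed.

Lemma psd_udiag n (U : 'M[C]_n) (d : 'rV[C]_n) : (forall i, 0 <= d 0 i) ->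
  psd (udiag U d).
Proof. by move=> d0; rewrite udiagE; apply: psd_conj; apply: psd_diag. Qed.

Lemma qf_row m n (P : 'M[C]_n) (U : 'M[C]_(m, n)) i :
  qf P (row i U) = (U *m P *m U^t*) i i.
Proof.
rewrite /qf /bil -row_mul !mxE; apply: eq_bigr => j _; rewrite !mxE.
by congr (_ * _); apply: eq_bigr => k _; rewrite !mxE.
Qed.

Lemma udiagK n (U : 'M[C]_n) (d : 'rV[C]_n) : U \is unitarymx ->
  U *m udiag U d *m U^t* = diag_mx d.
Proof.
move=> hU; rewrite /udiag !mulmxA (unitarymxP hU) mul1mx.
by rewrite -mulmxA (unitarymxP hU) mulmx1.
Qed.

Lemma udiag_diag n (U P : 'M[C]_n) d : U \is unitarymx ->
  U *m P *m U^t* = diag_mx d -> P = udiag U d.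
Proof.
move=> hU dE; rewrite /udiag -dE !mulmxA unitarymxPr // mul1mx -mulmxA.
by rewrite unitarymxPr // mulmx1.
Qed.

Lemma psd_spectral n (P : 'M[C]_n) : psd P ->
  exists (U : 'M[C]_n) (d : 'rV[C]_n), [/\ U \is unitarymx, forall i, 0 <=
    d 0 i & P = udiag U d].
Proof.
case=> hP P0; have nP : P \is normalmx by apply/normalmxP; rewrite hP.
have /orthomx_spectralP PE := nP; have hU := spectral_unitarymx P.
rewrite invmx_unitary // in PE.
exists (spectralmx P), (spectral_diag P); split=> // i.
have := P0 (row i (spectralmx P)); rewrite qf_row {2}PE -/(udiag _ _) udiagK //.
by rewrite mxE eqxx mulr1n.
Qed.

Lemma det_udiag n (U : 'M[C]_n) (d : 'rV[C]_n) : U \is unitarymx ->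
  \det (udiag U d) = \prod_i d 0 i.
Proof.
move=> hU; rewrite /udiag !det_mulmx mulrAC -(det_mulmx (U^t*)).
by rewrite unitarymxPr // det1 mul1r det_diag.
Qed.

Lemma psd_gramP n (P : 'M[C]_n) : psd P -> exists L : 'M[C]_n, P = L *m L^t*.
Proof.
case/psd_spectral => U [d [hU d0 ->]].
exists (U^t* *m diag_mx (\row_i sqrtC (d 0 i))).
rewrite adjM trmxCK adj_diag; last by move=> i; rewrite mxE sqrtC_ge0.
rewrite mulmxA /udiag -[_ *m diag_mx _ *m diag_mx _]mulmxA mulmx_diag.
by congr (_ *m diag_mx _ *m _); apply/rowP => i; rewrite !mxE -expr2 sqrtCK.
Qed.

(* Positivity of the block matrix [[a, - p], [- p^*, b]]. *)
Definition dom m n (p : 'M[C]_(m, n)) a b :=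
  forall x y, bil p x y + bil (p^t*) y x <= qf a x + qf b y.

Lemma domD m n (p q : 'M[C]_(m, n)) a b c d :
  dom p a b -> dom q c d -> dom (p + q) (a + c) (b + d).
Proof.
move=> h1 h2 x y; rewrite adjD !bilDm !qfDm addrACA [leRHS]addrACA lerD //.
Qed.

Lemma dom_le m n (p : 'M[C]_(m, n)) a b c d :
  (forall x, qf a x <= qf c x) -> (forall x, qf b x <= qf d x) ->
  dom p a b -> dom p c d.
Proof. by move=> h1 h2 h x y; apply: le_trans (h x y) _; rewrite lerD. Qed.

(** Congruence of the block matrix by the block diagonal matrix with blocks [X] and [Y]. *)
Lemma dom_conj m n k l (p : 'M[C]_(m, n)) a b (X : 'M_(k, m)) (Y : 'M_(l, n)) :
  dom p a b -> dom (X *m p *m Y^t*) (X *m a *m X^t*) (Y *m b *m Y^t*).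
Proof.
move=> h x y; rewrite !adjM trmxCK mulmxA !qfM !bilM; exact: h.
Qed.

Lemma psd_dom n (P : 'M[C]_n) : psd P -> dom P P P.
Proof.
move=> [hP P0] x y; have := P0 (x - y).
rewrite /qf bilBl !bilBr hP => h; rewrite -subr_ge0.
by move: h; congr (_ <= _); ring.
Qed.

(** Testing at [y = x K] gives [K K^* <= 1], and [|det K|^2] is the product of the eigenvalues of
    [K K^*], all in [0, 1]. *)
Lemma contraction_det n (K : 'M[C]_n) : dom K 1%:M 1%:M -> `|\det K| <= 1.
Proof.
move=> hK; have le1 x : qf (K *m K^t*) x <= qf 1%:M x.
  have := hK x (x *m K); rewrite qf_gram.
  have -> : bil K x (x *m K) = qf 1%:M (x *m K) by rewrite /qf /bil mulmx1.
  have -> : bil (K^t*) (x *m K) x = qf 1%:M (x *m K).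
    by rewrite /qf /bil mulmx1 adjM mulmxA.
  by rewrite lerD2r.
have [U [d [hU d0 KE]]] := psd_spectral (psd_gram K).
have : `|\det K| ^+ 2 <= 1.
  rewrite normCK -det_adj -det_mulmx KE det_udiag //.
  apply: prodr_ile1 => i _; rewrite d0 /=.
  have := le1 (row i U); rewrite !qf_row KE udiagK // mulmx1 (unitarymxP hU).
  by rewrite !mxE eqxx mulr1n.
by rewrite expr_le1.
Qed.

(** Congruence by the inverses of [S] and [T] turns [p] into a contraction. *)
Lemma dom_det n (p S T : 'M[C]_n) : S \in unitmx -> T \in unitmx ->
  dom p (S *m S^t*) (T *m T^t*) ->
  `|\det p| ^+ 2 <= \det (S *m S^t*) * \det (T *m T^t*).
Proof.
move=> hS hT hp.
have : dom (invmx S *m p *m (invmx T)^t*) 1%:M 1%:M.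
  have inv1 (X : 'M[C]_n) : X \in unitmx ->
    invmx X *m (X *m X^t*) *m (invmx X)^t* = 1%:M.
    by move=> hX; rewrite mulKmx // -adjM mulVmx // adj1.
  by have := dom_conj (invmx S) (invmx T) hp; rewrite !inv1.
move/contraction_det; rewrite !det_mulmx !det_adj !det_inv -!normCK => h.
have nS : `|\det S| > 0 by rewrite normr_gt0 -unitfE -unitmxE.
have nT : `|\det T| > 0 by rewrite normr_gt0 -unitfE -unitmxE.
rewrite -exprMn ler_pXn2r ?nnegrE ?mulr_ge0 //.
move: h; rewrite !normrM norm_conjC !normfV ler_pdivrMr // mul1r.
by rewrite ler_pdivrMl // mulrC.
Qed.

(** Both sides are the determinant of the block matrix [B]: its lower left block is eliminated once
    by columns and once by rows, the latter dividing by [c]. *)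
Lemma det_sylvester n (c : C) (X Y : 'M[C]_n) : c != 0 ->
  \det (c%:M + X *m Y) = \det (c%:M + Y *m X).
Proof.
move=> c0; pose B := block_mx (c%:M : 'M[C]_n) X (- Y) (1%:M : 'M[C]_n).
transitivity (\det B).
  have : \det (B *m block_mx 1%:M 0 Y 1%:M) =
    \det (block_mx (c%:M + X *m Y) X 0 1%:M).
    congr (\det _); rewrite mulmx_block !mulmx1 !mulmx0 !add0r !mul1mx.
    by rewrite addNr.
  by rewrite det_mulmx det_lblock det_ublock !det1 !mulr1 => ->.
have : \det (block_mx 1%:M 0 (c^-1 *: Y) 1%:M *m B)
     = \det (block_mx (c%:M) X 0 (1%:M + c^-1 *: (Y *m X))).
  congr (\det _); rewrite mulmx_block !mul1mx !mul0mx !addr0.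
  rewrite -!scalemxAl mul_mx_scalar scalerA mulVf // scale1r subrr.
  by rewrite [X in block_mx _ _ _ X]addrC.
rewrite det_mulmx det_lblock det_ublock !det1 !mul1r => ->.
rewrite -det_mulmx mul_scalar_mx scalerDr scalerA divff // scale1r.
by rewrite scale_scalar_mx mulr1.
Qed.

End Forms.

(** * Determinant inequalities for shifted matrices *)

Section Dets.
Local Open Scope sesquilinear_scope.
Local Open Scope ring_scope.
Variable C : numClosedFieldType.
Variable n : nat.
Implicit Types (P Q M X p : 'M[C]_n) (c : C).

Lemma psd_scalar c : 0 <= c -> psd (c%:M : 'M[C]_n).
Proof.
by move=> c0; rewrite -diag_const_mx; apply: psd_diag => i; rewrite mxE.
Qed.

Lemma det_shift_gt0 c P : 0 < c -> psd P -> 0 < \det (c%:M + P).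
Proof.
move=> c0 /psd_spectral [U [d [hU d0 ->]]].
have -> : c%:M + udiag U d = udiag U (\row_i (c + d 0 i)).
  apply: udiag_diag => //; rewrite mulmxDr mulmxDl udiagK // scalar_mxC.
  rewrite -mulmxA (unitarymxP hU) mulmx1 -diag_const_mx -linearD /=.
  by congr diag_mx; apply/rowP => i; rewrite !mxE.
rewrite det_udiag // prodr_gt0 // => i _.
by rewrite mxE ltr_wpDr.
Qed.

(** The shift by [c > 0] supplies the invertible Gram factors that [dom_det] requires. *)
Lemma shift_gramP c P : 0 < c -> psd P ->
  exists2 S : 'M[C]_n, S \in unitmx & c%:M + P = S *m S^t*.
Proof.
move=> c0 hP; have [|S SE] := @psd_gramP _ _ (c%:M + P).
  by apply: psdD => //; apply: psd_scalar; apply: ltW.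
exists S => //; rewrite unitmxE unitfE; apply/eqP => S0.
by have := det_shift_gt0 c0 hP; rewrite SE det_mulmx S0 mul0r ltxx.
Qed.

Lemma dom_shift_det c P Q p : 0 < c -> psd P -> psd Q ->
  dom p (c%:M + P) (c%:M + Q) ->
  `|\det p| ^+ 2 <= \det (c%:M + P) * \det (c%:M + Q).
Proof.
move=> c0 hP hQ; have [S hS ->] := shift_gramP c0 hP.
by have [T hT ->] := shift_gramP c0 hQ; apply: dom_det.
Qed.

(** If [P <= Q], then [c + P] is dominated by the pair [c + P], [c + Q]; in the resulting
    determinant bound one factor cancels. *)
Lemma det_shift_le c P Q : 0 < c -> psd P -> psd Q ->
  (forall x, qf P x <= qf Q x) -> \det (c%:M + P) <= \det (c%:M + Q).
Proof.
move=> c0 hP hQ leP; have dP := det_shift_gt0 c0 hP.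
have : dom (c%:M + P) (c%:M + P) (c%:M + Q).
  apply: (@dom_le _ _ _ _ (c%:M + P) (c%:M + P)) => // [x|].
    by rewrite !qfDm lerD2l.
  by apply: psd_dom; apply: psdD => //; apply: psd_scalar; apply: ltW.
move/(dom_shift_det c0 hP hQ).
by rewrite gtr0_norm // expr2 ler_pM2l.
Qed.

(** With [M = L L^*], Sylvester's identity replaces the two matrices by [c + L^* X^* X L] and
    [c + L^* L]. *)
Lemma det_compress_le c M X : 0 < c -> psd M ->
  (forall x, qf (X^t* *m X) x <= qf 1%:M x) ->
  \det (c%:M + X *m M *m X^t*) <= \det (c%:M + M).
Proof.
move=> c0 hM hX; have [L ->] := psd_gramP hM.
have cn0 : c != 0 by rewrite gt_eqF.
rewrite mulmxA -[X *m L *m _ *m _]mulmxA -adjM.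
rewrite (det_sylvester _ _ cn0) [leRHS](det_sylvester _ _ cn0).
have -> : (X *m L)^t* *m (X *m L) = L^t* *m (X^t* *m X) *m (L^t*)^t*.
  by rewrite trmxCK adjM !mulmxA.
have psdG (Y : 'M[C]_n) : psd (Y^t* *m Y).
  by have := psd_gram (Y^t*); rewrite trmxCK.
apply: det_shift_le => // [|x]; first by apply: psd_conj.
rewrite qfM; apply: le_trans (hX _) _.
by rewrite -qf_gram trmxCK.
Qed.

(* [X^* X] is the projection onto the row space of the partial isometry [X]. *)
Lemma partial_isometry_le1 X (e : 'M[C]_n) : X *m X^t* = e -> e *m X = X ->
  forall x, qf (X^t* *m X) x <= qf 1%:M x.
Proof.
move=> XX eX x; pose q := X^t* *m X.
have qq : q *m q = q by rewrite /q mulmxA -[_ *m X *m _]mulmxA XX -mulmxA eX.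
have hq : q^t* = q by rewrite adjM trmxCK.
have : 0 <= qf ((1%:M - q) *m (1%:M - q)^t*) x by apply: qf_gram_ge0.
rewrite adjB adj1 hq mulmxBl mul1mx mulmxBr mulmx1 qq subrr subr0.
by rewrite /qf bilBm subr_ge0.
Qed.

(* The rows of [X2] are the right singular vectors of [Z] indexed by [S], those
   of [X1] the corresponding left singular vectors. *)
Lemma dom_det_support c Z H M (U : 'M[C]_n) (s : 'rV[C]_n) (S : pred 'I_n) :
  0 < c -> psd M -> U \is unitarymx -> dom Z H H ->
  (forall x, qf H x <= qf (c%:M + M) x) ->
  Z^t* *m Z = udiag U (\row_i s 0 i ^+ 2) ->
  (forall i, S i -> 0 < s 0 i) ->
  \prod_i (if S i then s 0 i else c) <= \det (c%:M + M).
Proof.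
move=> c0 hM hU hZ leH ZE s0.
have hZ' : dom Z (c%:M + M) (c%:M + M) by apply: dom_le hZ.
pose I := diag_mx (\row_i (S i)%:R) : 'M[C]_n.
pose V := diag_mx (\row_i (if S i then (s 0 i)^-1 else 0)) : 'M[C]_n.
pose D := diag_mx (\row_i (if S i then s 0 i else 0)) : 'M[C]_n.
have hI : I^t* = I by apply: adj_diag => i; rewrite mxE ler0n.
have hV : V^t* = V.
  by apply: adj_diag => i; rewrite mxE; case: ifP => // /s0 /ltW;
    rewrite invr_ge0.
pose X1 := V *m U *m Z^t*; pose X2 := I *m U.
have X11 : X1 *m X1^t* = I.
  rewrite /X1 !adjM trmxCK hV !mulmxA -[_ *m Z^t* *m Z]mulmxA ZE.
  rewrite -[V *m U *m _]mulmxA -[V *m _ *m U^t*]mulmxA udiagK // !mulmx_diag.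
  congr diag_mx; apply/rowP => i; rewrite !mxE;
    case: (boolP (S i)) => [/s0 si|_]; last by rewrite !mul0r.
  by rewrite /=; field; rewrite gt_eqF.
have II : I *m I = I.
  by rewrite mulmx_diag; congr diag_mx; apply/rowP => i; rewrite !mxE;
    case: (S i); rewrite ?mulr1 ?mulr0.
have IV : I *m V = V.
  by rewrite mulmx_diag; congr diag_mx; apply/rowP => i; rewrite !mxE;
    case: (S i); rewrite ?mul1r ?mul0r.
have X22 : X2 *m X2^t* = I.
  by rewrite /X2 adjM hI mulmxA -[I *m U *m _]mulmxA (unitarymxP hU) mulmx1.
have X12 : X1 *m Z *m X2^t* = D.
  rewrite /X1 /X2 adjM hI !mulmxA -[_ *m Z^t* *m Z]mulmxA ZE.
  rewrite -[V *m U *m _]mulmxA -[V *m _ *m U^t*]mulmxA udiagK // !mulmx_diag.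
  congr diag_mx; apply/rowP => i; rewrite !mxE;
    case: (boolP (S i)) => [/s0 si|_]; last by rewrite !mul0r.
  by rewrite /=; field; rewrite gt_eqF.
have hE : psd (c *: (1%:M - I)).
  rewrite -diag_const_mx -linearB -linearZ /=; apply: psd_diag => i;
    rewrite !mxE.
  by case: (S i); rewrite ?subrr ?subr0 ?mulr0 ?mulr1 // ltW.
(* Off [S] the compressions vanish; the summand [c (1 - I)] fills the gap and provides the factors
   [c] of the product. *)
have dp : dom (D + c *: (1%:M - I)) (c%:M + X1 *m M *m X1^t*) (c%:M + X2 *m M
  *m X2^t*).
  have E X : X *m X^t* = I ->
      c%:M + X *m M *m X^t* = X *m (c%:M + M) *m X^t* + c *: (1%:M - I).
    move=> XX; rewrite mulmxDr mulmxDl mul_mx_scalar -scalemxAl XX scalerBr.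
    by rewrite addrAC addrCA subrr addr0 scalemx1.
  rewrite !E // -X12; apply: domD; [exact: dom_conj | exact: psd_dom].
have := dom_shift_det c0 (psd_conj _ hM) (psd_conj _ hM) dp.
have -> : D + c *: (1%:M - I) = diag_mx (\row_i (if S i then s 0 i else c)).
  rewrite -diag_const_mx -linearB -linearZ -linearD; congr diag_mx.
  apply/rowP => i; rewrite !mxE.
  by case: (S i); rewrite ?subrr ?subr0 ?mulr0 ?mulr1 ?addr0 ?add0r.
rewrite det_diag (eq_bigr (fun i => if S i then s 0 i else c));
  last by move=> i _; rewrite mxE.
have p0 : 0 <= \prod_i (if S i then s 0 i else c).
  by apply: prodr_ge0 => i _; case: ifP => [/s0/ltW|_] //; apply: ltW.
have d0 := det_shift_gt0 c0 hM.
rewrite ger0_norm // => h.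
(* Each of the two determinants in [h] is at most [det (c + M)], so squares are compared. *)
rewrite -(@ler_pXn2r _ 2) ?nnegrE // ?(ltW d0) //.
apply: le_trans h _; rewrite expr2.
have l1 := det_compress_le c0 hM (partial_isometry_le1 X11 (_ : I *m X1 = X1)).
have l2 := det_compress_le c0 hM (partial_isometry_le1 X22 (_ : I *m X2 = X2)).
apply: ler_pM; rewrite ?(ltW (det_shift_gt0 _ (psd_conj _ _))) //.
  by apply: l1; rewrite /X1 !mulmxA IV.
by apply: l2; rewrite /X2 !mulmxA II.
Qed.

End Dets.

(** * Weak majorization by averaged transpositions *)

Section Majorization.
Variables (R : realFieldType) (I : finType).
Implicit Types x y : I -> R.

(* Each step takes [j] with [y j < x j] and [x j] maximal, finds [i] with
   [x j <= x i < y i], and moves mass from [y i] to [y j] until one of the two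
   entries agrees with [x]. *)
Lemma majorization_ind x (Q : (I -> R) -> Prop) :
  (forall y, (forall l, x l <= y l) -> Q y -> Q x) ->
  (forall y i j t, x i < y i -> y j < x j -> 0 <= t <= 1 -> Q y ->
     Q (fun l => t * y l + (1 - t) * y (tperm i j l))) ->
  forall y, (forall t, \sum_(l | t <= x l) x l <= \sum_(l | t <= x l) y l) ->
  Q y -> Q x.
Proof.
move=> Qdown Qtperm y; have [k] := ubnP #|[pred l | x l != y l]|.
elim: k => // k IHk in y *; rewrite ltnS => yk xy Qy.
have [/existsP [j0 bad0]|] := boolP [exists j, y j < x j]; last first.
  by rewrite negb_exists => /forallP h; apply: Qdown Qy => l; rewrite leNgt.
case: (@Order.TotalTheory.arg_maxP _ _ _ j0 (fun j => y j < x j) x bad0) =>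
  j bad jmax.
(* Without such an [i], [y <= x] on the up-set of [x j], strictly at [j], against the hypothesis at
   the threshold [x j]. *)
have [/existsP [i /andP[ji xyi]]|] := boolP [exists i, (x j <=
  x i) && (x i < y i)]; last first.
  rewrite negb_exists => /forallP h; have := xy (x j).
  rewrite leNgt => /negP[]; rewrite (bigD1 j) //= [ltRHS](bigD1 j) //=.
  apply: ltr_leD => //; apply: ler_sum => l /andP[jl _].
  by have := h l; rewrite jl /= -leNgt.
have ij : i != j by apply: contraTneq xyi => ->; rewrite -leNgt ltW.
have yij : 0 < y i - y j by rewrite subr_gt0 (lt_le_trans bad) // (le_trans ji)
  // ltW.
pose d := Num.min (y i - x i) (x j - y j).
have d0 : 0 < d by rewrite lt_min !subr_gt0 xyi bad.
have dle : d <= y i - y j.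
  by rewrite ge_min; apply/orP; right; rewrite lerD2r (le_trans ji) // ltW.
(* With this weight, averaging over the transposition moves exactly [d] from [i] to [j]. *)
pose t := 1 - d / (y i - y j).
have t01 : 0 <= t <= 1.
  rewrite /t subr_ge0 ler_pdivrMr // mul1r dle /=.
  by rewrite gerBl divr_ge0 // ltW.
pose y' l := t * y l + (1 - t) * y (tperm i j l).
have y'i : y' i = y i - d.
  by rewrite /y' tpermL /t; field; rewrite gt_eqF.
have y'j : y' j = y j + d.
  by rewrite /y' tpermR /t; field; rewrite gt_eqF.
have y'D l : l != i -> l != j -> y' l = y l.
  by move=> li lj; rewrite /y' tpermD 1?eq_sym //; ring.
apply: (IHk y').
(* Both [i] and [j] were mismatched and one of them now agrees with [x], so the measure drops. *)
- apply: leq_trans yk; apply: proper_card; apply/properP; split.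
    apply/fintype.subsetP => l; rewrite !inE.
    have [->|li] := eqVneq l i; first by rewrite (lt_eqF xyi).
    have [->|lj] := eqVneq l j; first by rewrite (gt_eqF bad).
    by rewrite y'D.
  have [dE|dE] : d = y i - x i \/ d = x j - y j.
    by rewrite /d /Num.min; case: ifP; [left|right].
    by exists i; rewrite !inE ?(lt_eqF xyi) // y'i dE opprB addrC subrK eqxx.
  by exists j; rewrite !inE ?(gt_eqF bad) // y'j dE addrC subrK eqxx.
(* If [s <= x j], the up-set contains [i] and [j] and its sum is unchanged. Otherwise the maximality
   of [x j] and the choice of [d] give a termwise bound. *)
- move=> s; have [sj|js] := leP s (x j).
    have si := le_trans sj ji.
    apply: le_trans (xy s) _; rewrite /y' big_split /= -!mulr_sumr.
    have <- : \sum_(l | s <= x l) y l = \sum_(l | s <= x l) y (tperm i j l).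
      rewrite [LHS](reindex_inj (@perm_inj _ (tperm i j))) /=.
      by apply: eq_bigl => l; case: tpermP => [->|->|//]; rewrite sj si.
    by rewrite -mulrDl addrC subrK mul1r.
  apply: ler_sum => l sl.
  have [->|li] := eqVneq l i; first by rewrite y'i lerBrDr -lerBrDl ge_min lexx.
  have lj : l != j by apply: contraTneq sl => ->; rewrite -ltNge.
  rewrite y'D // leNgt; apply/negP => /jmax.
  by move/(le_trans sl)/(lt_le_trans js); rewrite ltxx.
- exact: Qtperm.
Qed.

(* A permutation maximising [sum x y], as in the rearrangement inequality. *)
Lemma comonotone_perm x y :
  exists s : {perm I}, forall i j, x j < x i -> y (s j) <= y (s i).
Proof.
pose F (s : {perm I}) := \sum_i x i * y (s i).
case: (@Order.TotalTheory.arg_maxP _ _ _ (1%g : {perm I}) predT F isT) =>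
  s _ smax.
exists s => i j xji; rewrite leNgt; apply/negP => ysij.
have := smax (tperm i j * s)%g isT; rewrite /= leNgt => /negP[].
have ij : i != j by apply: contraTneq xji => ->; rewrite ltxx.
rewrite /F (bigD1 i) // (bigD1 j) 1?eq_sym //= [ltRHS](bigD1 i) // [in
  ltRHS](bigD1 j) 1?eq_sym //=.
rewrite !permM tpermL tpermR.
rewrite [X in _ < _ + (_ + X)](eq_bigr (fun i => x i * y (s i))); last first.
  by move=> l /andP[li lj]; rewrite permM tpermD 1?eq_sym.
rewrite !addrA ltrD2r -subr_gt0.
(* Swapping [s i] and [s j] would raise the sum by this positive product. *)
have -> : x i * y (s j) + x j * y (s i) - (x i * y (s i) + x j * y (s j))
  = (x i - x j) * (y (s j) - y (s i)) by ring.
by rewrite mulr_gt0 // subr_gt0.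
Qed.
End Majorization.

(** * Concavity and e-convexity with explicit real weights *)

Section ConcaveBridge.
Local Open Scope convex_scope.
Local Open Scope ring_scope.
Variable R : realType.
Implicit Type f : R -> R.

Lemma concave_functionP f t x y : concave_function [set x : R | 0 <= x] f ->
  0 <= t <= 1 -> 0 <= x -> 0 <= y ->
    t * f x + (1 - t) * f y <= f (t * x + (1 - t) * y).
Proof.
move=> fc /andP[t0 t1] x0 y0.
have := fc (Itv01 t0 t1) x y; rewrite !inE => /(_ x0 y0).
by rewrite !convRE.
Qed.

Lemma e_convexP f t x y : e_convex f -> 0 <= t <= 1 ->
  f (expR (t * x + (1 - t) * y)) <= t * f (expR x) + (1 - t) * f (expR y).
Proof.
move=> fc /andP[t0 t1].
have := fc (Itv01 t0 t1) x y; rewrite !inE => /(_ I I).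
by rewrite !convRE.
Qed.
End ConcaveBridge.

(** * Nonnegative concave functions and sums over up-sets *)

Section Concave.
Variables (R : realFieldType) (f : R -> R).
Hypothesis f_ge0 : forall x, 0 <= x -> 0 <= f x.
Hypothesis fc : forall t x y, 0 <= t <= 1 -> 0 <= x -> 0 <= y ->
  t * f x + (1 - t) * f y <= f (t * x + (1 - t) * y).

Lemma concave_scale t x : 0 <= t <= 1 -> 0 <= x -> t * f x <= f (t * x).
Proof.
move=> t01 x0; have := fc t01 x0 (lexx 0); rewrite mulr0 addr0.
apply: le_trans; rewrite lerDl mulr_ge0 ?f_ge0 //.
by case/andP: t01; rewrite subr_ge0.
Qed.

(* If [f y < f x] with [x < y], concavity forces [f] to be negative far to the
   right of [y]. *)
Lemma concave_homo x y : 0 <= x -> x <= y -> f x <= f y.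
Proof.
move=> x0; rewrite le_eqVlt => /predU1P[->//|xy].
have y0 : 0 <= y by apply: ltW; apply: le_lt_trans xy.
rewrite leNgt; apply/negP => fyx.
have fx0 : 0 < f x by apply: le_lt_trans fyx; apply: f_ge0.
(* [t f x] is the mean of [f x] and [f y], which exceeds [f y]. As [y = t x + (1 - t) z] for the [z]
   below, concavity would force [f z < 0]. *)
pose t := (f x + f y) / (2 * f x).
have t0 : 0 < t by rewrite /t divr_gt0 ?mulr_gt0 // ltr_wpDr // f_ge0.
have t1 : t < 1 by rewrite /t ltr_pdivrMr ?mulr_gt0 // mul1r; lra.
have s0 : 0 < 1 - t by rewrite subr_gt0.
pose z := x + (y - x) / (1 - t).
have z0 : 0 <= z.
  by rewrite /z addr_ge0 // divr_ge0 ?(ltW s0) // subr_ge0 ltW.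
have t01 : 0 <= t <= 1 by rewrite !ltW.
have := fc t01 x0 z0.
have -> : t * x + (1 - t) * z = y by rewrite /z; field; rewrite gt_eqF.
have -> : t * f x = (f x + f y) / 2 by rewrite /t; field; rewrite gt_eqF.
have : 0 <= (1 - t) * f z by rewrite mulr_ge0 ?f_ge0 // ltW.
lra.
Qed.

Lemma concave_slope x y : 0 < x -> x <= y -> f y / y <= f x / x.
Proof.
move=> x0 xy; have y0 := lt_le_trans x0 xy.
rewrite ler_pdivlMr // mulrAC -[f y * x / y]mulrA mulrC.
have {2}-> : x = x / y * y by rewrite divfK // gt_eqF.
apply: concave_scale; last exact: ltW.
by rewrite divr_ge0 ?(ltW x0) ?(ltW y0) //= ler_pdivrMr // mul1r.
Qed.

(** Induction on the list, rescaling the tail by [1 - w i]. Missing mass costs nothing because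
    [f 0 >= 0]. *)
Lemma subconvex_jensen (I : Type) (s : seq I) (w u : I -> R) :
  (forall i, 0 <= w i) -> (forall i, 0 <= u i) -> \sum_(i <- s) w i <= 1 ->
  \sum_(i <- s) w i * f (u i) <= f (\sum_(i <- s) w i * u i).
Proof.
move=> w0 u0; elim: s w w0 => [|i s IHs] w w0.
  by rewrite !big_nil f_ge0.
rewrite !big_cons => W1.
have Ws : 0 <= \sum_(j <- s) w j by apply: sumr_ge0.
have wi1 : w i <= 1 by apply: le_trans W1; rewrite lerDl.
move: wi1; rewrite le_eqVlt => /predU1P[wi|wi].
  have z0 (g : I -> R) : \sum_(j <- s) w j * g j = 0.
    have W0 : \sum_(j <- s) w j = 0 by apply/eqP; rewrite eq_le Ws andbT; lra.
    elim: s W0 {IHs W1 Ws} => [|j s IH]; first by rewrite !big_nil.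
    rewrite !big_cons => /eqP; rewrite paddr_eq0 ?sumr_ge0 //.
    move=> /andP[/eqP-> /eqP/IH->]; by rewrite mul0r addr0.
  by rewrite !z0 wi !addr0 !mul1r.
have s0 : 0 < 1 - w i by rewrite subr_gt0.
pose w' j := w j / (1 - w i).
have w'E (g : I -> R) : \sum_(j <- s) w j * g j =
  (1 - w i) * \sum_(j <- s) w' j * g j.
  rewrite mulr_sumr; apply: eq_bigr => j _; rewrite /w'; field.
  by rewrite gt_eqF.
rewrite !w'E.
have w'0 j : 0 <= w' j by rewrite divr_ge0 // ltW.
have t01 : 0 <= w i <= 1 by rewrite w0 ltW.
have m0 : 0 <= \sum_(j <- s) w' j * u j.
  by apply: sumr_ge0 => j _; rewrite mulr_ge0.
apply: le_trans (fc t01 (u0 i) m0).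
rewrite lerD2l ler_pM2l //; apply: IHs => //.
by rewrite -mulr_suml ler_pdivrMr // mul1r lerBrDl.
Qed.

(* Terms with [m l = 0] contribute 0 to the sum of the [v k l / m l]. *)
Lemma upset_sum_le (K L : finType) (p : K -> R) (v : K -> L -> R) (m : L -> R)
    (S : pred L) :
  (forall k, 0 <= p k) -> (forall k l, 0 <= v k l) ->
  (forall k, \sum_l v k l = 1) ->
  (forall l, \sum_k p k * v k l = m l) ->
  (forall k, p k * (\sum_l v k l / m l) <= 1) ->
  (forall l, 1 <= \sum_k v k l) ->
  (forall l l', S l -> ~~ S l' -> m l' <= m l) ->
  \sum_(l | S l) f (m l) <= \sum_(l | S l) \sum_k f (p k) * v k l.
Proof.
move=> p0 v0 v1 mE pv v1' Sup.
have m0 l : 0 <= m l by rewrite -mE sumr_ge0 // => k _; rewrite mulr_ge0.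
have mz k l : m l = 0 -> p k * v k l = 0.
  rewrite -mE => /eqP; rewrite psumr_eq0; last by move=> j _; rewrite mulr_ge0.
  by move=> /allP/(_ k (mem_index_enum _))/eqP.
pose P l := S l && (0 < m l).
rewrite (bigID (fun l => 0 < m l)) [leRHS](bigID (fun l => 0 < m l)) /=.
apply: lerD; last first.
  apply: ler_sum => l /andP[_ ml].
  have {}ml : m l = 0 by apply/eqP; rewrite eq_le m0 andbT leNgt.
  (* Here [p k * v k l = 0], so each term equals [f 0 * v k l]; the sum of [v k l] over [k] is at
     least 1. *)
  rewrite ml (eq_bigr (fun k => f 0 * v k l)); last first.
    move=> k _; have /eqP := mz k l ml; rewrite mulf_eq0.
    by move=> /orP[/eqP->|/eqP->]; rewrite ?mulr0.
  by rewrite -mulr_sumr ler_peMr ?f_ge0.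
rewrite exchange_big /=.
(* If [m l > 0], these weights sum to 1 over [k]. For fixed [k] their mass is at most 1 and, if
   [p k > 0], they combine the [m l] into [p k]. *)
pose w k l := p k * v k l / m l.
have w0 k l : 0 <= w k l by rewrite divr_ge0 // mulr_ge0.
have -> : \sum_(l | P l) f (m l) = \sum_k \sum_(l | P l) w k l * f (m l).
  rewrite exchange_big /=; apply: eq_bigr => l /andP[_ ml].
  by rewrite -mulr_suml /w -mulr_suml mE divff ?mul1r // gt_eqF.
apply: ler_sum => k _; rewrite -mulr_sumr.
have [pk|pk] := leP (p k) 0.
  have {}pk : p k = 0 by apply/eqP; rewrite eq_le pk p0.
  rewrite big1 ?mulr_ge0 ?f_ge0 ?sumr_ge0 // => l _.
  by rewrite /w pk !mul0r.
have vz l : m l = 0 -> v k l = 0.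
  by move=> /(mz k)/eqP; rewrite mulf_eq0 gt_eqF //= => /eqP.
have fp : \sum_l w k l * f (m l) <= f (p k).
  have -> : p k = \sum_l w k l * m l.
    rewrite -[LHS]mulr1 -(v1 k) mulr_sumr; apply: eq_bigr => l _; rewrite /w.
    have [/vz->|ml] := eqVneq (m l) 0; first by rewrite mulr0 !mul0r.
    by rewrite divfK.
  apply: subconvex_jensen => //.
  by rewrite (eq_bigr (fun l => p k * (v k l / m l))) -?mulr_sumr // => l _;
    rewrite /w mulrA.
(* Chebyshev: under the probability weights [v k], the slopes [g] on [P] are at most those off [P]
   that carry weight, so the part over [P] is at most the mass of [P] times the total. *)
pose g l := f (m l) / m l.
have wg l : w k l * f (m l) = p k * (v k l * g l) by rewrite /w /g; ring.
apply: le_trans (ler_wpM2r (sumr_ge0 _ _) fp); last by [].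
under eq_bigr do rewrite wg; under [X in _ <= X * _]eq_bigr do rewrite wg.
rewrite -!mulr_sumr -mulrA ler_pM2l // [X in _ <= X * _](bigID P) /=.
have vE : \sum_(l | ~~ P l) v k l = 1 - \sum_(l | P l) v k l.
  by have := v1 k; rewrite (bigID P) /= => <-; rewrite addrC addrK.
set A := \sum_(l | P l) v k l * g l; set a := \sum_(l | P l) v k l.
set B := \sum_(l | ~~ P l) _.
suff : A * (1 - a) <= B * a by rewrite -/(P _); lra.
rewrite -vE /A /B !big_distrlr /= [leRHS]exchange_big /=.
apply: ler_sum => l /andP[Sl ml]; apply: ler_sum => l' Pl'.
have [/vz->|ml'] := eqVneq (m l') 0; first by rewrite mulr0 !mul0r.
have {}ml' : 0 < m l' by rewrite lt_def ml' m0.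
have Sl' : ~~ S l' by move: Pl'; rewrite negb_and ml' orbF.
have : g l <= g l' by apply: concave_slope => //; apply: Sup.
move/(ler_wpM2l (mulr_ge0 (v0 k l) (v0 k l'))).
by congr (_ <= _); ring.
Qed.
End Concave.

(** * From weak log-majorization to symmetric gauges *)

Section LogMajorization.
Variables (R : realType) (I : finType).
Variable Phi : (I -> R) -> R.
Hypothesis Phi_le : forall x y, (forall l, 0 <= x l <= y l) -> Phi x <= Phi y.
Hypothesis Phi_perm : forall (s : {perm I}) x, Phi (fun l => x (s l)) = Phi x.
Hypothesis Phi_conv : forall t x y, 0 <= t <= 1 ->
  Phi (fun l => t * x l + (1 - t) * y l) <= t * Phi x + (1 - t) * Phi y.
Variable f : R -> R.
Hypothesis f_ge0 : forall x, 0 <= x -> 0 <= f x.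
Hypothesis f_homo : forall x y, 0 <= x -> x <= y -> f x <= f y.
Hypothesis f_econvex : forall t x y, 0 <= t <= 1 ->
  f (expR (t * x + (1 - t) * y)) <= t * f (expR x) + (1 - t) * f (expR y).

(* Since [f] may jump at 0, vanishing entries cannot be perturbed: comparing
   orders in [c -> 0] shows that, once both families are sorted alike, [a]
   vanishes wherever [b] does, and these entries are left untouched. *)
Lemma log_majorization (a b : I -> R) :
  (forall l, 0 <= a l) -> (forall l, 0 <= b l) ->
  (forall c (S : pred I), 0 < c -> (forall l, S l -> 0 < a l) ->
     \prod_l (if S l then a l else c) <= \prod_l Num.max (b l) c) ->
  Phi (fun l => f (a l)) <= Phi (fun l => f (b l)).
Proof.
move=> a0 b_ge0 hprod'.
have [s hs] := comonotone_perm a b.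
rewrite -(Phi_perm s (fun l => f (b l))).
pose d l := b (s l); rewrite -/(d _).
have d0 l : 0 <= d l by apply: b_ge0.
have hprod c (S : pred I) : 0 < c -> (forall l, S l -> 0 < a l) ->
    \prod_l (if S l then a l else c) <= \prod_l Num.max (d l) c.
  by move=> c0 hS; apply: le_trans (hprod' c S c0 hS) _;
    rewrite [leLHS](reindex_inj (@perm_inj _ s)).
have hd i j : a j < a i -> d j <= d i by apply: hs.
have max0 c l : 0 < c -> 0 < Num.max (d l) c by move=> c0;
  rewrite lt_max c0 orbT.
have topprod c th : 0 < c -> 0 < th ->
    \prod_(l | th <= a l) a l <= \prod_(l | th <= a l) Num.max (d l) c.
  move=> c0 th0.
  have [[j0 j0S]|S0] := pselect (exists j, th <= a j); last first.
    by rewrite !big_pred0 // => l; apply/negP => hl; apply: S0; exists l.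
  case: (@Order.TotalTheory.arg_minP _ _ _ j0 (fun j =>
    th <= a j) (fun j => Num.max (d j) c) j0S) => j jS jmin.
  (* With [c1] as cutoff, every entry off the up-set counts as [c1] on both sides, and these factors
     cancel. *)
  pose c1 := Num.max (d j) c; have c10 : 0 < c1 by apply: max0.
  have := hprod c1 (fun l => th <= a l) c10 (fun l => lt_le_trans th0).
  rewrite (bigID (fun l => th <= a l)) [leRHS](bigID (fun l => th <= a l)) /=.
  rewrite [X in _ * X <= _](eq_bigr (fun=> c1)); last by move=> l /negPf->.
  rewrite [X in _ <= _ * X](eq_bigr (fun=> c1)); last first.
    move=> l; rewrite -ltNge => hl; apply/max_idPr.
    by rewrite le_max hd // (lt_le_trans hl).
  rewrite ler_pM2r; last by apply: prodr_gt0.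
  rewrite (eq_bigr a); last by move=> l ->.
  rewrite [leRHS](eq_bigr (fun l => Num.max (d l) c)) // => l /jmin.
  rewrite -/c1 /= => h.
  have cc1 : c <= c1 by rewrite le_max lexx orbT.
  move: c1 {c10} h cc1 => e h cc1; by apply: le_anti;
    rewrite !ge_max h !le_max !lexx cc1 !orbT.
have zero l : d l = 0 -> a l = 0.
  move=> dl; apply/eqP; rewrite eq_le a0 andbT leNgt; apply/negP => al.
  pose K := \prod_(j | a l <= a j) a j.
  have K0 : 0 < K by apply: prodr_gt0 => j; apply: lt_le_trans.
  pose M := \prod_(j | (a l <= a j) && (j != l)) Num.max (d j) 1.
  have M0 : 0 < M by apply: prodr_gt0 => j _; apply: max0.
  (* Makes [c * M <= K / 2], whereas [topprod] bounds the fixed [K > 0] by at most [c * M]. *)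
  pose c := Num.min 1 (K / (2 * M)).
  have c0 : 0 < c by rewrite lt_min ltr01 divr_gt0 // mulr_gt0.
  have c1 : c <= 1 by rewrite ge_min lexx.
  have := topprod c (a l) c0 al;
    rewrite -/K (bigD1 l) //= dl (max_idPr (ltW c0)).
  rewrite leNgt => /negP[].
  apply: (@le_lt_trans _ _ (c * M)).
    rewrite ler_pM2l //; apply: ler_prod => j _; rewrite ltW ?max0 //=.
    by rewrite ge_max !le_max lexx c1 !orbT.
  apply: (@le_lt_trans _ _ (K / 2)).
    have -> : K / 2 = K / (2 * M) * M by field; rewrite gt_eqF.
    by rewrite ler_pM2r // ge_min lexx orbT.
  by rewrite ltr_pdivrMr //; lra.
(* At most every nonzero [d l], so truncation at [c] leaves the positive entries of [d]
   unchanged. *)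
pose c : R := \big[Num.min/1]_(l | d l != 0) d l.
have c0 : 0 < c.
  rewrite /c; elim/big_rec: _ => // l x dl x0.
  by rewrite lt_min x0 andbT lt_def dl d0.
have cd l : d l != 0 -> c <= d l.
  by move=> dl; rewrite /c (bigD1 l) //= ge_min lexx.
pose la l := ln (Num.max (a l) c); pose lb l := ln (Num.max (d l) c).
have maxa0 l : 0 < Num.max (a l) c by rewrite lt_max c0 orbT.
have ela l : expR (la l) = Num.max (a l) c by rewrite lnK // posrE.
have elb l : expR (lb l) = Num.max (d l) c by rewrite lnK // posrE max0.
pose F y l := if d l == 0 then f 0 else f (expR (y l)).
have F0 y l : 0 <= F y l by rewrite /F; case: ifP => _; apply: f_ge0 => //;
  apply: expR_ge0.
(* Agreement with [la] on the zeros of [d] keeps them out of the transpositions, which involve only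
   indices where [y] and [la] differ. *)
pose Q (y : I -> R) := (forall l, d l = 0 ->
  y l = la l) /\ Phi (F y) <= Phi (fun l => f (d l)).
suff [_ Qa] : Q la.
  apply: le_trans Qa; apply: Phi_le => l; rewrite f_ge0 //= /F.
  case: eqP => [/zero->//|_]; rewrite ela; apply: f_homo => //.
  by rewrite le_max lexx.
apply: (@majorization_ind _ _ la Q _ _ lb).
- move=> y ly [Q1 Q2]; split=> //; apply: le_trans Q2; apply: Phi_le => l.
  rewrite F0 /= /F; case: ifP => // _; apply: f_homo; first exact: expR_ge0.
  by rewrite ler_expR.
- move=> y i j t hi hj t01 [Q1 Q2].
  have di : d i != 0 by apply: contraTneq hi => /Q1->; rewrite ltxx.
  have dj : d j != 0 by apply: contraTneq hj => /Q1->; rewrite ltxx.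
  split=> [l dl|].
    rewrite tpermD; first by rewrite Q1 //; ring.
      by apply: contraNneq di => ->; rewrite dl.
    by apply: contraNneq dj => ->; rewrite dl.
  apply: le_trans Q2.
  pose G l := t * F y l + (1 - t) * F y (tperm i j l).
  apply: (@le_trans _ _ (Phi G)).
    apply: Phi_le => l; rewrite F0 /= /G.
    have dt : (d (tperm i j l) == 0) = (d l == 0).
      by case: tpermP => [->|->|//]; rewrite (negPf di) (negPf dj).
    rewrite /F dt; case: ifP => _; last exact: f_econvex.
    by rewrite le_eqVlt; apply/orP; left; apply/eqP; ring.
  apply: le_trans (Phi_conv _ _ t01) _.
  by rewrite Phi_perm -mulrDl addrC subrK mul1r.
(* Sums of logarithms become products. For [expR t <= c] the up-set is everything and [hprod]
   applies with [S] the set where [c < a l]; otherwise it is an up-set of [a] and [topprod]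
   applies. *)
- move=> t; rewrite -ler_expR !expR_sum.
  under eq_bigr do rewrite ela; under [leRHS]eq_bigr do rewrite elb.
  have tE l : (t <= la l) = (expR t <=
    Num.max (a l) c) by rewrite -ela ler_expR.
  rewrite (eq_bigl _ _ tE) [leRHS](eq_bigl _ _ tE).
  have [tc|ct] := leP (expR t) c.
    have all l : (expR t <= Num.max (a l) c) = true by rewrite le_max tc orbT.
    rewrite !(eq_bigl _ _ all).
    have hS l : c < a l -> 0 < a l by apply: lt_trans.
    rewrite (eq_bigr (fun l => if c < a l then a l else c)); first exact: hprod.
    by move=> l _; case: (ltP c (a l)) => [/ltW/max_idPl|/max_idPr].
  have sE l : (expR t <= Num.max (a l) c) = (expR t <= a l).
    by rewrite le_max [X in _ || X]leNgt ct orbF.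
  rewrite !(eq_bigl _ _ sE) (eq_bigr a); first exact: topprod (expR_gt0 _).
  by move=> l tl; apply/max_idPl; rewrite (le_trans (ltW ct)).
- split=> [l dl|]; first by rewrite /la /lb dl zero.
  apply: Phi_le => l; rewrite F0 /= /F elb.
  by case: eqP => [->//|/eqP/cd/max_idPl->].
Qed.

End LogMajorization.

(** * Normal matrices and unitary diagonalisation *)

Section NormalMatrices.
Local Open Scope sesquilinear_scope.
Local Open Scope complex_scope.
Local Open Scope ring_scope.
Variable C : numClosedFieldType.

(** Polar decomposition: [a = u |a|] with [u] unimodular, set to 1 where [a] vanishes. Since [u]
    commutes with [|a|], congruence by [u] and 1 leaves both bounds equal to [|a|]. *)
Lemma dom_normal n (U : 'M[C]_n) (a : 'rV[C]_n) :
  dom (udiag U a) (udiag U (map_mx Num.norm a)) (udiag U (map_mx Num.norm a)).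
Proof.
pose u := \row_i (if a 0 i == 0 then 1 else a 0 i / `|a 0 i|).
have h := dom_conj (diag_mx u) 1%:M
  (psd_dom (psd_diag (fun i => _ : 0 <= (map_mx Num.norm a) 0 i))).
rewrite !udiagE; apply: dom_conj.
have nu i : `|u 0 i| = 1.
  rewrite mxE; case: eqP => [_|/eqP ai]; first by rewrite normr1.
  by rewrite normrM normfV normr_id divff // normr_eq0.
have e1 : diag_mx a = diag_mx u *m diag_mx (map_mx Num.norm a) *m (1%:M)^t*.
  rewrite adj1 mulmx1 mulmx_diag; congr diag_mx; apply/rowP => i; rewrite !mxE.
  case: eqP => [->|/eqP ai]; first by rewrite normr0 mulr0.
  by rewrite divfK // normr_eq0.
have e2 : diag_mx (map_mx Num.norm a) =
    diag_mx u *m diag_mx (map_mx Num.norm a) *m (diag_mx u)^t*.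
  rewrite tr_diag_mx map_diag_mx !mulmx_diag; congr diag_mx; apply/rowP => i.
  have : `|a 0 i| = u 0 i * `|a 0 i| * (u 0 i)^*.
    by rewrite mulrAC -normCK nu expr1n mul1r.
  by rewrite !mxE.
have e3 : diag_mx (map_mx Num.norm a) =
    1%:M *m diag_mx (map_mx Num.norm a) *m (1%:M)^t*.
  by rewrite adj1 mul1mx mulmx1.
by rewrite -e1 -e2 -e3 in h; apply: h => i; rewrite mxE.
Qed.

(** [T = W U^*] intertwines [e] and [d], so [T i j] is nonzero only if [e i = d j]; hence it also
    intertwines [g e] and [g d]. *)
Lemma udiag_calculus n (g : C -> C) (U W : 'M[C]_n) (d e : 'rV[C]_n) :
  U \is unitarymx -> W \is unitarymx -> udiag W e = udiag U d ->
  udiag W (map_mx g e) = udiag U (map_mx g d).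
Proof.
move=> hU hW eqWU; have [T TE] : exists T, T = W *m U^t* by eexists.
have eT i j : e 0 i * T i j = T i j * d 0 j.
  have : diag_mx e *m T = T *m diag_mx d.
    have WP : W *m udiag W e = diag_mx e *m W.
      by rewrite /udiag !mulmxA (unitarymxP hW) mul1mx.
    have PU : udiag U d *m U^t* = U^t* *m diag_mx d.
      by rewrite /udiag -mulmxA (unitarymxP hU) mulmx1.
    rewrite TE mulmxA -WP eqWU.
    by rewrite -(mulmxA W (udiag _ _)) PU mulmxA.
  by move=> /matrixP/(_ i j); rewrite mul_diag_mx mul_mx_diag !mxE.
apply: udiag_diag => //.
have GT : diag_mx (map_mx g e) *m T = T *m diag_mx (map_mx g d).
  apply/matrixP => i j; rewrite mul_diag_mx mul_mx_diag !mxE.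
  have [->|Tij] := eqVneq (T i j) 0; first by rewrite mulr0 mul0r.
  have -> : e 0 i = d 0 j by apply: (mulIf Tij); rewrite eT mulrC.
  by rewrite mulrC.
have TT : T^t* *m T = 1%:M.
  by apply: unitarymxPr; rewrite TE mul_unitarymx // trmxC_unitary.
rewrite -[RHS]mul1mx -TT -(mulmxA (T^t*)) -GT TE adjM trmxCK /udiag.
by rewrite !mulmxA.
Qed.

Lemma udiag_adj n (U : 'M[C]_n) (d : 'rV[C]_n) :
  (udiag U d)^t* = udiag U (map_mx Num.conj d).
Proof. by rewrite /udiag !adjM trmxCK mulmxA tr_diag_mx map_diag_mx. Qed.

Lemma udiag_mul n (U : 'M[C]_n) (a b : 'rV[C]_n) : U \is unitarymx ->
  udiag U a *m udiag U b = udiag U (\row_i (a 0 i * b 0 i)).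
Proof.
move=> hU; rewrite /udiag !mulmxA -[_ *m U *m U^t*]mulmxA (unitarymxP hU)
  mulmx1.
by rewrite -[_ *m diag_mx a *m _]mulmxA mulmx_diag.
Qed.

Lemma normal_spectral n (A : 'M[C]_n) : A \is normalmx ->
  A = udiag (spectralmx A) (spectral_diag A).
Proof.
by move/orthomx_spectralP; rewrite (invmx_unitary (spectral_unitarymx A)).
Qed.

Lemma adj_unitary n (U : 'M[C]_n) :
  U \is unitarymx -> U^t* \is unitarymx.
Proof. by rewrite trmxC_unitary. Qed.

Lemma qf_udiag n (U : 'M[C]_n) (d x : 'rV[C]_n) :
  qf (udiag U d) x = \sum_i d 0 i * `|(x *m U^t*) 0 i| ^+ 2.
Proof. by rewrite udiagE qfM qf_diag. Qed.

Lemma qf_udiagMV n (U : 'M[C]_n) (d x : 'rV[C]_n) :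
  U \is unitarymx -> qf (udiag U d) (x *m U) = \sum_i d 0 i * `|x 0 i| ^+ 2.
Proof. by move=> hU; rewrite qf_udiag -mulmxA (unitarymxP hU) mulmx1. Qed.

End NormalMatrices.

(** * Functional calculus and absolute values *)

Section RealSpectrum.
Local Open Scope sesquilinear_scope.
Local Open Scope complex_scope.
Local Open Scope ring_scope.
Variables (R : realType) (n : nat).
Local Notation C := R[i].
Implicit Types (U V : 'M[C]_n) (d : 'I_n -> R) (f : R -> R).

Definition rc d : 'rV[C]_n := \row_i (d i)%:C.

Lemma realcK (z : C) : 0 <= z -> (complex.Re z)%:C = z.
Proof. by move=> z0; rewrite RRe_real // ger0_real. Qed.

(** Frees [mxfun] from the particular diagonalisation in its definition. *)
Lemma mxfun_udiag f U d : U \is unitarymx ->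
  mxfun f (udiag U (rc d)) = udiag U (rc (f \o d)).
Proof.
move=> hU; have [P PE] : exists P, P = udiag U (rc d) by eexists.
have nP : P \is normalmx.
  apply/normalmxP; have hP : P^t* = P; last by rewrite hP.
  rewrite PE udiag_adj; congr udiag.
  by apply/rowP => i; rewrite !mxE; apply: conjc_real.
rewrite -PE /mxfun (invmx_unitary (spectral_unitarymx P)).
have := normal_spectral nP; rewrite {1}PE => /esym h.
have := udiag_calculus (fun z : C =>
  (f (complex.Re z))%:C) hU (spectral_unitarymx P) h.
rewrite {1}/udiag => ->; congr udiag.
by apply/rowP => i; rewrite !mxE.
Qed.

Lemma psd_real_spectral (P : 'M[C]_n) : psd P ->
  exists U d, [/\ U \is unitarymx, forall i, 0 <= d i & P = udiag U (rc d)].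
Proof.
case/psd_spectral => U [d [hU d0 ->]]; exists U, (fun i => complex.Re (d 0 i)).
split; [exact: hU|by move=> i; rewrite -ler0c realcK|].
by congr udiag; apply/rowP => i; rewrite mxE realcK.
Qed.

(** Provides the singular values [s] of [X], with right singular vectors the rows of [U]. *)
Lemma mxabs_sqr (X : 'M[C]_n) : exists U s, [/\ U \is unitarymx,
  forall i, 0 <= s i, mxabs X = udiag U (rc s) &
  X^t* *m X = udiag U (\row_i (rc s) 0 i ^+ 2)].
Proof.
have : psd (X^t* *m X) by have := psd_gram (X^t*); rewrite trmxCK.
case/psd_real_spectral => U [d [hU d0 XE]]; exists U, (Num.sqrt \o d).
split; [exact: hU|by move=> i; exact: sqrtr_ge0| |].
  rewrite /mxabs XE; exact: mxfun_udiag.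
rewrite XE; congr udiag; apply/rowP => i.
by rewrite !mxE -rmorphXn /= sqr_sqrtr.
Qed.

Lemma normal_mxabs (A : 'M[C]_n) : A \is normalmx -> dom A (mxabs A) (mxabs A).
Proof.
move=> /normal_spectral.
move: (spectralmx A) (spectral_diag A) (spectral_unitarymx A) => U a hU AE.
suff -> : mxabs A = udiag U (map_mx Num.norm a) by rewrite {1}AE;
  exact: dom_normal.
pose d i := complex.Re `|a 0 i|.
have dE i : (d i)%:C = `|a 0 i| by rewrite /d realcK.
have d0 i : 0 <= d i by rewrite -ler0c dE.
rewrite /mxabs.
have -> : A^t* *m A = udiag U (rc (fun i => d i ^+ 2)).
  have -> : A^t* = udiag U (map_mx Num.conj a).
    rewrite AE; exact: udiag_adj.
  rewrite AE (udiag_mul _ _ hU); congr udiag; apply/rowP => i.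
  by rewrite !mxE rmorphXn /= dE normCK mulrC.
rewrite (mxfun_udiag _ _ hU); congr udiag; apply/rowP => i.
by rewrite !mxE /= sqrtr_sqr ger0_norm.
Qed.

End RealSpectrum.

(** * Symmetric gauge functions and pinching *)

Section Gauge.
Local Open Scope sesquilinear_scope.
Local Open Scope complex_scope.
Local Open Scope ring_scope.
Variables (R : realType) (n : nat) (N : 'M[R[i]]_n -> R).
Hypothesis hN : symmetric_norm N.
Local Notation C := R[i].
Implicit Types (U X Y : 'M[C]_n) (d x y : 'I_n -> R).

Lemma unitary1 : (1%:M : 'M[C]_n) \is unitarymx.
Proof. by apply/unitarymxP; rewrite adj1 mulmx1. Qed.

Lemma diag_unitary (u : 'rV[C]_n) : (forall i, `|u 0 i| = 1) ->
  diag_mx u \is unitarymx.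
Proof.
move=> hu; apply/unitarymxP;
  rewrite tr_diag_mx map_diag_mx mulmx_diag -diag_const_mx.
congr diag_mx; apply/rowP => i;
  have : u 0 i * (u 0 i)^* = 1 by rewrite -normCK hu expr1n.
by rewrite !mxE.
Qed.

Lemma norm_conv t X Y : 0 <= t <= 1 ->
  N (t%:C *: X + (1 - t)%:C *: Y) <= t * N X + (1 - t) * N Y.
Proof.
move=> /andP[t0 t1]; apply: le_trans (symmetric_normD hN _ _) _.
have normr s : 0 <= s -> Normc.normc (s%:C : C) = s.
  by move=> s0; rewrite /= expr0n addr0 sqrtr_sqr ger0_norm.
by rewrite !(symmetric_normZ hN) !normr // subr_ge0.
Qed.

(** The symmetric gauge function associated with [N]. *)
Definition gauge d := N (diag_mx (rc d)).

Lemma norm_udiag U d : U \is unitarymx -> N (udiag U (rc d)) = gauge d.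
Proof. by move=> hU; rewrite /udiag (symmetric_normU hN) // trmxC_unitary. Qed.

Lemma gauge_conv t x y : 0 <= t <= 1 ->
  gauge (fun l => t * x l + (1 - t) * y l) <= t * gauge x + (1 - t) * gauge y.
Proof.
move=> t01; rewrite /gauge.
have -> : diag_mx (rc (fun l => t * x l + (1 - t) * y l))
    = t%:C *: diag_mx (rc x) + (1 - t)%:C *: diag_mx (rc y).
  rewrite -!linearZ -linearD; congr diag_mx; apply/rowP => i.
  by rewrite !mxE rmorphD !rmorphM.
exact: norm_conv.
Qed.

Lemma gauge_perm (s : {perm 'I_n}) x : gauge (fun l => x (s l)) = gauge x.
Proof.
have hs : (perm_mx s : 'M[C]_n) \is unitarymx.
  apply/unitarymxP; rewrite tr_perm_mx.
  have -> : map_mx Num.conj (perm_mx s^-1 : 'M[C]_n) = perm_mx s^-1.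
    by rewrite map_perm_mx.
  by rewrite -perm_mxM mulgV perm_mx1.
rewrite /gauge -[RHS](symmetric_normU hN _ hs (_ :
  (perm_mx s)^t* \is unitarymx)); last first.
  by rewrite trmxC_unitary.
congr N; rewrite tr_perm_mx map_perm_mx -row_permE -col_permE.
apply/matrixP => i j; rewrite !mxE.
by rewrite (inj_eq perm_inj).
Qed.

(* [x] is the average of [y w] and [y w^*] for a unimodular [w]. *)
Lemma gauge_le x y : (forall l, 0 <= x l <= y l) -> gauge x <= gauge y.
Proof.
(* Where [y l = 0], also [x l = 0], and division by 0 yields [r l = 0]. *)
move=> xy; pose r l := x l / y l.
have y0 l : 0 <= y l by case/andP: (xy l) => a; apply: le_trans.
have r01 l : 0 <= r l <= 1.
  case/andP: (xy l) => x0 lxy; rewrite /r divr_ge0 //=.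
  have [->|yl] := eqVneq (y l) 0; first by rewrite invr0 mulr0.
  by rewrite ler_pdivrMr ?mul1r // lt_def yl y0.
have rE l : y l * r l = x l.
  rewrite /r; have [yl|yl] := eqVneq (y l) 0; last by rewrite mulrC divfK.
  by have := xy l; rewrite yl mul0r; apply: le_anti.
pose w b : 'rV[C]_n := \row_l (r l +i* ((-1) ^+ b * Num.sqrt (1 - r l ^+ 2))).
have hw b : diag_mx (w b) \is unitarymx.
  apply: diag_unitary => l; rewrite mxE normc_def /= [(_ * Num.sqrt _) ^+
    2]exprMn sqrr_sign mul1r.
  rewrite sqr_sqrtr; first by rewrite addrC subrK sqrtr1.
  by case/andP: (r01 l) => a b'; rewrite subr_ge0 expr_le1.
have half : 0 <= (2^-1 : R) <= 1 by lra.
have E : diag_mx (rc x) = (2^-1)%:C *: (1%:M *m diag_mx (rc y) *m diag_mx (w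
  false))
    + (1 - 2^-1)%:C *: (1%:M *m diag_mx (rc y) *m diag_mx (w true)).
  rewrite !mul1mx !mulmx_diag -!linearZ -linearD; congr diag_mx;
    apply/rowP => l.
  rewrite !mxE -rE; simpc; congr (_ +i* _); rewrite ?expr0 ?expr1; by field.
rewrite /gauge E; apply: le_trans (norm_conv _ _ half) _.
by rewrite !(symmetric_normU hN) ?unitary1 //; lra.
Qed.

(** Splits off the indices in [s] as blocks of size 1; for [s] the full enumeration only the
    diagonal remains. *)
Definition pinch (s : seq 'I_n) X : 'M[C]_n :=
  \matrix_(k, l) (if all (fun i => (k == i) == (l == i)) s then X k l else 0).

(** Pinching at [i] averages a matrix with its conjugate by the diagonal sign matrix with -1 at [i]
    only: entries with exactly one index equal to [i] cancel. *)
Lemma norm_pinch s X : N (pinch s X) <= N X.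
Proof.
elim: s => [|i s IHs].
  by rewrite le_eqVlt; apply/orP; left; apply/eqP; congr N;
    apply/matrixP => k l; rewrite mxE.
pose u : 'rV[C]_n := \row_k (-1) ^+ (k == i).
have hu : diag_mx u \is unitarymx.
  by apply: diag_unitary => k; rewrite mxE normrX normrN1 expr1n.
have half : 0 <= (2^-1 : R) <= 1 by lra.
have -> : pinch (i :: s) X = (2^-1)%:C *: pinch s X
    + (1 - 2^-1)%:C *: (diag_mx u *m pinch s X *m diag_mx u).
  apply/matrixP => k l; rewrite mul_diag_mx mul_mx_diag !mxE /=.
  have -> : 1 - 2^-1 = 2^-1 :> R by field.
  case: (all _ s); last by rewrite andbF !(mulr0, mul0r) addr0.
  rewrite andbT; have h : 2^-1%:C + 2^-1%:C = 1 :> C.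
    by rewrite -rmorphD /=; congr (_%:C); field.
  case: (k == i); case: (l == i);
    rewrite /= ?expr0 ?expr1 ?mul1r ?mulr1 ?mulN1r ?mulrN1 ?opprK -?mulrDl ?h
    ?mul1r //.
    by rewrite mulrN subrr.
  by rewrite mulrN subrr.
apply: le_trans (norm_conv _ _ half) _.
rewrite (symmetric_normU hN) //; lra.
Qed.

Lemma norm_diag_le X : N (diag_mx (\row_i X i i)) <= N X.
Proof.
apply: le_trans (norm_pinch (enum 'I_n) X); rewrite le_eqVlt; apply/orP; left.
apply/eqP; congr N; apply/matrixP => k l; rewrite !mxE.
have -> : all (fun i => (k == i) == (l == i)) (enum 'I_n) = (k == l).
  apply/allP/eqP => [/(_ k)|->//];
    rewrite mem_enum eqxx => /(_ isT)/eqP/esym/eqP.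
  by [].
by case: eqP => [->|]; rewrite ?mulr1n ?mulr0n.
Qed.

End Gauge.

(** * Singular value products and overlaps of eigenbases *)

Section EigenbasisWeights.
Local Open Scope sesquilinear_scope.
Local Open Scope complex_scope.
Local Open Scope ring_scope.
Variables (R : realType) (n : nat).
Local Notation C := R[i].
Implicit Types (U V P : 'M[C]_n) (d p m : 'I_n -> R) (f : R -> R).

Lemma psd_real_udiag U d : (forall i, 0 <= d i) -> psd (udiag U (rc d)).
Proof. by move=> d0; apply: psd_udiag => i; rewrite mxE ler0c. Qed.

Lemma det_real_udiag U d : U \is unitarymx ->
  \det (udiag U (rc d)) = (\prod_i d i)%:C.
Proof.
move=> hU; rewrite (det_udiag _ hU) rmorph_prod.
by apply: eq_bigr => i _; rewrite mxE.
Qed.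

(* [dom_det_support] with [M] the positive part of [H - c]. *)
Lemma dom_prod_le (Z : 'M[C]_n) U V (s m : 'I_n -> R) c (S : pred 'I_n) :
  U \is unitarymx -> V \is unitarymx ->
  dom Z (udiag V (rc m)) (udiag V (rc m)) ->
  Z^t* *m Z = udiag U (\row_i (rc s) 0 i ^+ 2) ->
  0 < c -> (forall i, S i -> 0 < s i) ->
  \prod_i (if S i then s i else c) <= \prod_i Num.max (m i) c.
Proof.
move=> hU hV hZ ZE c0 s0.
pose M := udiag V (rc (fun i => Num.max (m i) c - c)).
have cM : c%:C%:M + M = udiag V (rc (fun i => Num.max (m i) c)).
  apply: (udiag_diag hV); rewrite mulmxDr mulmxDl (udiagK _ hV) scalar_mxC.
  rewrite -mulmxA (unitarymxP hV) mulmx1 -diag_const_mx -linearD /=.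
  by congr diag_mx; apply/rowP => i; rewrite !mxE -rmorphD /= addrC subrK.
have hM : psd M.
  by apply: psd_real_udiag => i; rewrite subr_ge0 le_max lexx orbT.
have le x : qf (udiag V (rc m)) x <= qf (c%:C%:M + M) x.
  have : 0 <= qf (udiag V (rc (fun i => Num.max (m i) c - m i))) x.
    by case: (psd_real_udiag V (fun i =>
      _ : 0 <= Num.max (m i) c - m i)) => [i|_ ->];
      rewrite // subr_ge0 le_max lexx.
  have -> : rc (fun i => Num.max (m i) c - m i) = rc (fun i =>
    Num.max (m i) c) - rc m.
    by apply/rowP => i; rewrite !mxE rmorphB.
  have -> : udiag V (rc (fun i =>
    Num.max (m i) c) - rc m) = c%:C%:M + M - udiag V (rc m).
    by rewrite cM /udiag linearB /= mulmxBr mulmxBl.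
  by rewrite /qf bilBm subr_ge0.
have sS i : S i -> 0 < (rc s) 0 i by move=> /s0; rewrite mxE -ltcR.
have c0' : 0 < c%:C :> C by rewrite -ltcR in c0.
have := dom_det_support c0' hM hU hZ le ZE sS.
rewrite cM (det_real_udiag _ hV) (eq_bigr (fun i =>
  (if S i then s i else c)%:C)).
  by rewrite -rmorph_prod lecR.
by move=> i _; case: ifP => // _; rewrite mxE.
Qed.

(** For [W = V U^*], the squared overlap of row [l] of [V] with row [i] of [U]. *)
Definition weight (W : 'M[C]_n) (l i : 'I_n) : R := complex.Re (`|W l i| ^+ 2).

Lemma weightE W l i : (weight W l i)%:C = `|W l i| ^+ 2.
Proof. by rewrite realcK // exprn_ge0. Qed.

Lemma weight_ge0 W l i : 0 <= weight W l i.
Proof. by rewrite -ler0c weightE exprn_ge0. Qed.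

Lemma weight_row W l : W \is unitarymx -> \sum_i weight W l i = 1.
Proof.
move=> /unitarymxP/matrixP/(_ l l); rewrite !mxE eqxx => E.
apply: complexI; rewrite rmorph_sum /= -[RHS]E; apply: eq_bigr => i _.
by rewrite weightE normCK !mxE.
Qed.

Lemma weight_col W i : W \is unitarymx -> \sum_l weight W l i = 1.
Proof.
move=> /unitarymxPr/matrixP/(_ i i); rewrite !mxE eqxx => E.
apply: complexI; rewrite rmorph_sum /= -[RHS]E; apply: eq_bigr => l _.
by rewrite weightE normCK !mxE mulrC.
Qed.

Lemma udiag_entry V U p l :
  (V *m udiag U (rc p) *m V^t*) l l = (\sum_i p i * weight (V *m U^t*) l i)%:C.
Proof.
rewrite -qf_row udiagE qfM qf_diag rmorph_sum /=; apply: eq_bigr => i _.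
by rewrite rmorphM /= weightE mxE -row_mul mxE.
Qed.

(* Test [p u u^* <= H] on [x = H^-1 u]. *)
Lemma weight_le1 U V p m i : U \is unitarymx -> V \is unitarymx ->
  (forall j, 0 <= p j) -> (forall l, 0 <= m l) ->
  (forall x, qf (udiag U (rc p)) x <= qf (udiag V (rc m)) x) ->
  p i * (\sum_l weight (V *m U^t*) l i / m l) <= 1.
Proof.
move=> hU hV p0 m0 le; set W := V *m U^t*; set S := \sum_l _.
have S0 : 0 <= S by apply: sumr_ge0 => l _; rewrite divr_ge0 // weight_ge0.
(* Coordinates of the inverse of [H] applied to row [i] of [U], in the basis [V]; zeros of [m]
   contribute 0. *)
pose y : 'rV[C]_n := \row_l ((W l i)^* / (m l)%:C).
have qV : qf (udiag V (rc m)) (y *m V) = S%:C.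
  rewrite (qf_udiagMV _ _ hV) rmorph_sum /=; apply: eq_bigr => l _.
  rewrite [(rc m) 0 l]mxE [y 0 l]mxE normrM normfV norm_conjC exprMn -weightE
    rmorphM fmorphV /=.
  rewrite ger0_norm ?ler0c //.
  have [->|ml] := eqVneq (m l) 0; first by rewrite invr0 mul0r mulr0.
  have ml' : (m l)%:C != 0 :> C by rewrite (inj_eq (@complexI _)).
  by field.
have yW : (y *m V *m U^t*) 0 i = S%:C.
  rewrite -mulmxA -/W mxE rmorph_sum /=; apply: eq_bigr => l _.
  by rewrite [y 0 l]mxE rmorphM fmorphV /= weightE normCK; ring.
(* Only the [i]-th term of the form on the left is kept; dividing by [S] then concludes unless
   [S = 0]. *)
have h : (p i * S ^+ 2)%:C <= S%:C :> C.
  rewrite -qV; apply: le_trans (le _); rewrite qf_udiag (bigD1 i) //= yW mxE.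
  rewrite ger0_norm ?ler0c // -rmorphXn -rmorphM /= lerDl sumr_ge0 // => j _.
  by rewrite mulr_ge0 ?exprn_ge0 // mxE ler0c.
move: h; rewrite lecR => h.
have [->|Sn] := eqVneq S 0; first by rewrite mulr0.
by rewrite -(@ler_pM2r _ S) ?mul1r -?mulrA -?expr2 // lt_def Sn.
Qed.

End EigenbasisWeights.

(** * Norm inequalities for domination and subadditivity *)

Section SymmetricNormInequalities.
Local Open Scope sesquilinear_scope.
Local Open Scope complex_scope.
Local Open Scope ring_scope.
Variables (R : realType) (n : nat) (N : 'M[R[i]]_n -> R) (f : R -> R).
Hypothesis hN : symmetric_norm N.
Hypothesis f_ge0 : forall x : R, 0 <= x -> 0 <= f x.
Hypothesis f_concave : concave_function [set x : R | 0 <= x] f.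
Local Notation C := R[i].

Let fc := fun t x y => concave_functionP f_concave (t := t) (x := x) (y := y).

(** Monotonicity, convexity and symmetry of the gauge mean that no step of [majorization_ind]
    increases it. *)
Lemma gauge_majorization (x y : 'I_n -> R) : (forall l, 0 <= x l) ->
  (forall t, \sum_(l | t <= x l) x l <= \sum_(l | t <= x l) y l) ->
  gauge N x <= gauge N y.
Proof.
move=> x0 xy; pose Q z := gauge N z <= gauge N y.
apply: (@majorization_ind _ _ x Q _ _ y xy); last exact: lexx.
- by move=> z xz; apply: le_trans; apply: gauge_le => // l; rewrite x0 xz.
- move=> z i j t _ _ t01; apply: le_trans;
    apply: le_trans (gauge_conv hN _ _ t01) _.
  by rewrite (gauge_perm hN) -mulrDl addrC subrK mul1r.
Qed.

Lemma norm_mxfun_dom (Z H : 'M[C]_n) : e_convex f -> psd H -> dom Z H H ->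
  N (mxfun f (mxabs Z)) <= N (mxfun f H).
Proof.
move=> f_econvex /psd_real_spectral[V [m [hV m0 ->]]] hZ.
have [U [s [hU s0 -> ZE]]] := mxabs_sqr Z.
rewrite (mxfun_udiag _ _ hU) (mxfun_udiag _ _ hV) !(norm_udiag hN) //.
apply: log_majorization => //.
- exact: gauge_le.
- exact: gauge_perm.
- exact: gauge_conv.
- exact: concave_homo fc.
- by move=> t x y; apply: e_convexP.
- by move=> c S c0 hS; apply: (dom_prod_le hU hV hZ ZE).
Qed.

Lemma norm_mxfun_subadd (P Q : 'M[C]_n) : psd P -> psd Q ->
  N (mxfun f (P + Q)) <= N (mxfun f P + mxfun f Q).
Proof.
move=> hP hQ.
have [V [m [hV m0 HE]]] := psd_real_spectral (psdD hP hQ).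
have leP x : qf P x <= qf (udiag V (rc m)) x.
  by rewrite -HE qfDm lerDl; case: hQ.
have leQ x : qf Q x <= qf (udiag V (rc m)) x.
  by rewrite -HE qfDm lerDr; case: hP.
rewrite HE; move: leP leQ HE.
have [U [p [hU p0 ->]]] := psd_real_spectral hP.
have [W [q [hW q0 ->]]] := psd_real_spectral hQ.
move=> leP leQ HE.
rewrite (mxfun_udiag _ _ hU) (mxfun_udiag _ _ hW) (mxfun_udiag _ _ hV)
  (norm_udiag hN) //.
set T := udiag U _ + _.
have hT : N (V *m T *m V^t*) =
  N T by apply: (symmetric_normU hN T hV (adj_unitary hV)).
(* The eigenvectors of [P] and [Q] are pooled into one family, as [upset_sum_le] expects. *)
pose w (k : 'I_n + 'I_n) l := match k with
  | inl i => weight (V *m U^t*) l i | inr i => weight (V *m W^t*) l i end.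
pose pq (k : 'I_n + 'I_n) := match k with inl i => p i | inr i => q i end.
have hVU : V *m U^t* \is unitarymx := mul_unitarymx hV (adj_unitary hU).
have hVW : V *m W^t* \is unitarymx := mul_unitarymx hV (adj_unitary hW).
pose d l := \sum_k f (pq k) * w k l.
have TE l : (V *m T *m V^t*) l l = (d l)%:C.
  by rewrite /T mulmxDr mulmxDl mxE !udiag_entry /d big_sumType rmorphD.
have dE : \row_l (V *m T *m V^t*) l l = rc d.
  by apply/rowP => l; rewrite [LHS]mxE TE [RHS]mxE.
have := norm_diag_le hN (V *m T *m V^t*); rewrite dE hT; apply: le_trans.
apply: gauge_majorization => [l|t]; first exact: f_ge0.
apply: (@upset_sum_le _ f f_ge0 fc).
- by case.
- by case=> i l; apply: weight_ge0.
- by case=> i; [exact: (weight_col i hVU) | exact: (weight_col i hVW)].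
- move=> l; apply: complexI; rewrite big_sumType rmorphD /= -!udiag_entry.
  transitivity ((V *m udiag V (rc m) *m V^t*) l l).
    by rewrite -HE mulmxDr mulmxDl [RHS]mxE.
  by rewrite (udiagK _ hV) !mxE eqxx.
- by case=> i; apply: weight_le1.
- by move=> l; rewrite big_sumType /= (weight_row l hVU) (weight_row l hVW)
    lerDl.
(* As [f] is nondecreasing, the set where [t <= f (m l)] is an up-set of the spectrum. *)
- move=> l l' /= tl; rewrite -ltNge => l't; rewrite leNgt; apply/negP => ll'.
  have := le_lt_trans (concave_homo f_ge0 fc (m0 l) (ltW ll')) l't.
  by rewrite ltNge tl.
Qed.

End SymmetricNormInequalities.

Theorem corollary1p5 (R : realType) (n : nat) (A B : 'M[R[i]]_n) (f : R -> R)
    (hA : A \is normalmx) (hB : B \is normalmx)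
    (f_ge0 : forall x : R, 0 <= x -> 0 <= f x)
    (f_concave : concave_function [set x : R | 0 <= x] f)
    (f_econvex : e_convex f)
    (N : 'M[R[i]]_n -> R) (hN : symmetric_norm N) :
  N (mxfun f (mxabs (A + B))) <= N (mxfun f (mxabs A) + mxfun f (mxabs B)).
Proof.
have psd_abs (X : 'M[R[i]]_n) : psd (mxabs X).
  by have [U [s [_ s0 -> _]]] := mxabs_sqr X; apply: psd_real_udiag.
have hdom := domD (normal_mxabs hA) (normal_mxabs hB).
apply: (@le_trans _ _ (N (mxfun f (mxabs A + mxabs B)))).
  by apply: norm_mxfun_dom => //; apply: psdD.
exact: norm_mxfun_subadd.
Qed.
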